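(* Let $G$ be a group with a finite generating set $S$, and suppose that $G$ has finite abelianization. Then, for each $n\geq 1$, the element $\square_n$ is an order unit in $I[G]$, and the matrix $\operatorname{diag}(\square_n)$ is an order unit in $\mathbb{M}_{|S|\times |S|}(I[G])$.
   Context: For a group $G$, $\mathbb{R}G$ is the real group ring (finitely supported functions $G\to\mathbb{R}$, written $\xi=\sum_g \xi(g)g$, with convolution product), equipped with the involution $*$ that is the linear extension of $g\mapsto g^{-1}$. The augmentation ideal $I[G]$ is the kernel of the augmentation map $\omega:\mathbb{R}G\to\mathbb{R}$, $\omega(\sum_g\xi(g)g)=\sum_g\xi(g)$. The matrices $\mathbb{M}_{k\times k}(\mathbb{R}G)$ form a $*$-algebra, with involution given by the composition of matrix transposition and the entrywise involution of $\mathbb{R}G$; $\mathbb{M}_{k\times k}(I[G])$ is the subspace of matrices with all entries in $I[G]$. For a $*$-algebra $\mathcal{A}$, the cone of sums of hermitian squares $\Sigma^2\mathcal{A}$ is the set of finite sums $\sum_{i=1}^l a_i^*a_i$ with $a_i\in\mathcal{A}$. For a subspace $V\subseteq\mathcal{A}$, an element $u\in V$ is an order unit in $V$ if for every $v=v^*\in V$ there exists $R_v\geq 0$ such that $v+R_vu\in V\cap\Sigma^2\mathcal{A}$. For $V=I[G]$ the ambient algebra is $\mathcal{A}=\mathbb{R}G$; for $V=\mathbb{M}_{|S|\times|S|}(I[G])$ it is $\mathcal{A}=\mathbb{M}_{|S|\times|S|}(\mathbb{R}G)$. For a finite generating set $S$ of $G$, define $\square_0=1$ and, for $n\geq 1$,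 $$\square_n=\sum_{s_1,\ldots,s_n\in S}(1-s_n)^*\cdots(1-s_1)^*(1-s_1)\cdots(1-s_n)\in\mathbb{R}G.$$ For $\xi\in\mathbb{R}G$, $\operatorname{diag}(\xi)$ denotes the diagonal $|S|\times|S|$ matrix with every diagonal entry equal to $\xi$. *)

(* Defs.v *)
From HB Require Import structures.
From mathcomp Require Import all_boot all_order all_algebra finmap.
From mathcomp Require Import classical_sets cardinality reals.
From mathcomp.multinomials Require Import monalg.

Set Implicit Arguments.
Unset Strict Implicit.
Unset Printing Implicit Defensive.

Import GRing.Theory Num.Theory.

Local Open Scope classical_set_scope.
Local Open Scope fset_scope.
Local Open Scope ring_scope.

Section Groups.
Variable G : groupType.

Definition is_subgroup (H : set G) : Prop :=
  [/\ H 1%g, forall x y, H x -> H y -> H (x * y)%g & forall x, H x -> H x^-1%g].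

Definition generated (A : set G) : set G := smallest is_subgroup A.

Definition generates (S : {fset G}) : Prop := generated [set` S] = setT.

Definition commutator_subgroup : set G :=
  generated [set z | exists x y : G, z = [~ x, y]%g].

Definition lcoset (H : set G) (g : G) : set G := [set x | H (g^-1 * x)%g].

(* The underlying set of G / [G, G], as a set of cosets. *)
Definition abelianization : set (set G) := range (lcoset commutator_subgroup).

End Groups.

Arguments commutator_subgroup : clear implicits.
Arguments abelianization : clear implicits.

(* monalg equips {malg R[K]} with a product only when K is a monomType, in
   which 1 has no nontrivial factorization; this excludes nontrivial groups.
   Hence the alias, with its own convolution product. *)
Definition group_ring (R : nzRingType) (G : groupType) : Type := {malg R[G]}.

HB.instance Definition _ (R : nzRingType) (G : groupType) :=
  GRing.Lmodule.copy (group_ring R G) {malg R[G]}.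

Definition gring_of (R : nzRingType) (G : groupType) (g : G) : group_ring R G :=
  << g >>.

Section GroupRing.
Variables (R : nzRingType) (G : groupType).
Implicit Types (x y z : group_ring R G).

Definition gring_mul x y : group_ring R G :=
  \sum_(g <- msupp x) \sum_(h <- msupp y) << x@_g * y@_h *g (g * h)%g >>.

Lemma gring_mulw (d1 d2 : {fset G}) x y : msupp x `<=` d1 -> msupp y `<=` d2 ->
  gring_mul x y =
    \sum_(g <- d1) \sum_(h <- d2) << x@_g * y@_h *g (g * h)%g >>.
Proof.
move=> le_d1 le_d2; rewrite /gring_mul (big_fset_incl _ le_d1) /=.
  apply/eq_bigr=> k1 _; apply/big_fset_incl => // k _ /mcoeff_outdom ->.
  by rewrite mulr0 monalgU0.
move=> k _ /mcoeff_outdom xk.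
by rewrite big1 => // k' _; rewrite xk mul0r monalgU0.
Qed.

Lemma gring_mulDl : left_distributive gring_mul +%R.
Proof.
move=> x y z; have sU := fsubset_refl (msupp z).
rewrite (gring_mulw (msuppD_le x y) sU).
rewrite (gring_mulw (fsubsetUl (msupp x) (msupp y)) sU).
rewrite (gring_mulw (fsubsetUr (msupp x) (msupp y)) sU).
rewrite -big_split /=; apply/eq_bigr=> k1 _.
rewrite -big_split /=; apply/eq_bigr=> k2 _.
by rewrite mcoeffD mulrDl monalgUD.
Qed.

Lemma gring_mulDr : right_distributive gring_mul +%R.
Proof.
move=> z x y; have sU := fsubset_refl (msupp z).
rewrite (gring_mulw sU (msuppD_le x y)).
rewrite (gring_mulw sU (fsubsetUl (msupp x) (msupp y))).
rewrite (gring_mulw sU (fsubsetUr (msupp x) (msupp y))).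
rewrite -big_split /=; apply/eq_bigr=> k1 _.
rewrite -big_split /=; apply/eq_bigr=> k2 _.
by rewrite mcoeffD mulrDr monalgUD.
Qed.

Lemma gring_mul0l : left_zero 0 gring_mul.
Proof. by move=> x; rewrite /gring_mul msupp0 big_seq_fset0. Qed.

Lemma gring_mul0r : right_zero 0 gring_mul.
Proof.
by move=> x; rewrite /gring_mul big1 // => g _; rewrite msupp0 big_seq_fset0.
Qed.

Lemma gring_mulUU (c d : R) (g h : G) :
  gring_mul << c *g g >> << d *g h >> = << c * d *g (g * h)%g >>.
Proof. by rewrite (gring_mulw msuppU_le msuppU_le) !big_seq_fset1 !mcoeffUU. Qed.

Lemma gring_mul_suml I (r : seq I) (F : I -> group_ring R G) y :
  gring_mul (\sum_(i <- r) F i) y = \sum_(i <- r) gring_mul (F i) y.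
Proof.
exact: (big_morph (gring_mul^~ y) (fun _ _ => gring_mulDl _ _ _) (gring_mul0l y)).
Qed.

Lemma gring_mul_sumr I (r : seq I) (F : I -> group_ring R G) x :
  gring_mul x (\sum_(i <- r) F i) = \sum_(i <- r) gring_mul x (F i).
Proof.
exact: (big_morph (gring_mul x) (fun _ _ => gring_mulDr _ _ _) (gring_mul0r x)).
Qed.

Lemma gring_mulA : associative gring_mul.
Proof.
move=> x y z; rewrite [x]monalgE (gring_mul_suml _ _ (gring_mul y z)).
rewrite (gring_mul_suml _ _ y) (gring_mul_suml _ _ z); apply: eq_bigr => g _.
set a := << _ *g g >>; rewrite [y]monalgE (gring_mul_suml _ _ z).
rewrite !(gring_mul_sumr _ _ a) (gring_mul_suml _ _ z); apply: eq_bigr => h _.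
set b := << _ *g h >>; rewrite [z]monalgE (gring_mul_sumr _ _ b).
rewrite (gring_mul_sumr _ _ a) (gring_mul_sumr _ _ (gring_mul a b)).
apply: eq_bigr => k _.
by rewrite {}/a {}/b !gring_mulUU mulrA mulgA.
Qed.

Lemma gring_mul1l : left_id (gring_of R 1%g) gring_mul.
Proof.
move=> x; rewrite [x]monalgE gring_mul_sumr; apply: eq_bigr => g _.
by rewrite gring_mulUU mul1r mul1g.
Qed.

Lemma gring_mul1r : right_id (gring_of R 1%g) gring_mul.
Proof.
move=> x; rewrite [x]monalgE gring_mul_suml; apply: eq_bigr => g _.
by rewrite gring_mulUU mulr1 mulg1.
Qed.

Lemma gring_1_neq0 : gring_of R (1%g : G) != 0.
Proof. by rewrite monalgU_eq0 oner_eq0. Qed.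

HB.instance Definition _ := GRing.Zmodule_isNzRing.Build (group_ring R G)
  gring_mulA gring_mul1l gring_mul1r gring_mulDl gring_mulDr gring_1_neq0.

Lemma gring_scaleAl (c : R) x y : c *: (x * y) = (c *: x) * y.
Proof.
have scaleE z : c *: z = gring_mul << c *g 1%g >> z.
  rewrite [z in RHS]monalgE gring_mul_sumr; apply: eq_bigr => g _.
  by rewrite gring_mulUU mul1g.
by rewrite !scaleE; apply: gring_mulA.
Qed.

HB.instance Definition _ :=
  GRing.Lmodule_isLalgebra.Build R (group_ring R G) gring_scaleAl.

Definition gring_star x : group_ring R G :=
  \sum_(g <- msupp x) << x@_g *g g^-1%g >>.

Definition augmentation x : R := \sum_(g <- msupp x) x@_g.

Definition augmentation_ideal : {pred group_ring R G} :=
  [pred x | augmentation x == 0].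

(* Big products over 'I_n multiply in increasing index order, so rev_ord makes
   the starred factors run from s_n down to s_1. *)
Definition square (S : {fset G}) (n : nat) : group_ring R G :=
  \sum_(s : {ffun 'I_n -> S})
    (\prod_(i < n) gring_star (1 - gring_of R (val (s (rev_ord i)))))
    * \prod_(i < n) (1 - gring_of R (val (s i))).

End GroupRing.

Arguments augmentation_ideal : clear implicits.
Arguments square R {G} S n.

Lemma gring_starE (R : nzRingType) (G : groupType) (x : group_ring R G) (g : G) :
  (gring_star x)@_g = x@_(g^-1%g).
Proof.
rewrite [x in RHS]monalgE !raddf_sum /=; apply: eq_bigr => h _.
by rewrite !mcoeffU (can2_eq invgK invgK).
Qed.

(* Entrywise action of R on matrices over an R-algebra; the canonical Lmodule
   structure on 'M[A]_k has its scalars in A. *)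
Definition mx_scale (R : nzRingType) (A : lalgType R) k (c : R) (M : 'M[A]_k) :
  'M[A]_k := map_mx (fun a => c *: a) M.

Definition mx_star (A : Type) (star : A -> A) k (M : 'M[A]_k) : 'M[A]_k :=
  map_mx star M^T.

(* The scalar action is a parameter: over a ring A, 'M[A]_0 is only a
   pzRingType, hence not an lalgType. *)
Section OrderUnit.
Variables (R : numDomainType) (A : pzRingType).
Variables (scale : R -> A -> A) (star : A -> A).

Definition sum_of_hermitian_squares (x : A) : Prop :=
  exists s : seq A, x = \sum_(a <- s) star a * a.

Definition order_unit (V : {pred A}) (u : A) : Prop :=
  u \in V /\
  forall v : A, v \in V -> star v = v ->
    exists2 r : R, 0 <= r
      & v + scale r u \in V /\ sum_of_hermitian_squares (v + scale r u).

End OrderUnit.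

(* Main.v *)
(* Since G has finite abelianization, the augmentation ideal satisfies I = I^2,
   hence I = I^3.  As I is generated by the 1 - s, s in S, both as a left ideal
   and (with stars) as a right ideal, induction on n gives that I is the additive
   span of the elements p^* (c g) q, where c is real, g is in G, and p, q are
   words (1 - s_1) ... (1 - s_n).  A hermitian matrix over I is thus a sum of
   matrices E_ij p^* (c g) q + E_ji (p^* (c g) q)^*, and adding
   E_ii p^* p + c^2 E_jj q^* q turns such a term into Z^* Z with
   Z = E_ii p + E_ij (c g) q.  The added diagonal terms are bounded by
   (1 + c^2) diag(square_n), which is (1 + c^2) times the sum of all
   E_ll p^* p.  The scalar case is that of 1 x 1 matrices. *)
From HB Require Import structures.
Require Import Defs.
From mathcomp Require Import all_boot all_order all_algebra finmap.
From mathcomp Require Import classical_sets cardinality reals.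
From mathcomp.multinomials Require Import monalg.

Set Implicit Arguments.
Unset Strict Implicit.
Unset Printing Implicit Defensive.

Import Order.TTheory GRing.Theory Num.Theory.

Local Open Scope fset_scope.
Local Open Scope ring_scope.

(** * Generated subgroups and torsion of the abelianization *)

Lemma generated_ind (G : groupType) (A : set G) (P : G -> Prop) :
  P 1%g -> (forall x y, P x -> P y -> P (x * y)%g) ->
  (forall x, P x -> P x^-1%g) -> (forall x, A x -> P x) ->
  forall x, generated A x -> P x.
Proof.
move=> P1 PM PV PA; apply: (@smallest_sub _ _ _ P).
  by split.
exact: PA.
Qed.

(** Pigeonhole: the cosets of the powers of [g] lie in a finite set, so two powers [g ^+ i] and
    [g ^+ j] with [i < j] share a coset, and [N = j - i] works. *)
Lemma expg_commutator_subgroup (G : groupType) :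
  finite_set (abelianization G) ->
  forall g : G, exists2 N, (0 < N)%N & commutator_subgroup G (g ^+ N)%g.
Proof.
move=> finG g.
have [K1 KM KV] : is_subgroup (commutator_subgroup G).
  split=> [|x y Kx Ky|x Kx] H subH; have [[H1 HM HV] _] := subH => //.
    by apply: HM; [apply: Kx | apply: Ky].
  by apply: HV; apply: Kx.
pose f k := lcoset (commutator_subgroup G) (g ^+ k)%g.
have [inj_f | ] := boolp.pselect (injective f).
  case: infinite_nat; have -> : ([set: nat] = f @^-1` abelianization G)%classic.
    by apply/esym/seteqP; split=> // k _; exists (g ^+ k)%g.
  by apply: finite_preimage finG => i j _ _; apply: inj_f.
move=> /boolp.existsNP[i /boolp.existsNP[j /boolp.not_implyP[eq_f /eqP neq_ij]]].
wlog lt_ij : i j eq_f neq_ij / (i < j)%N => [IH|].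
  have /orP[lt_ij|lt_ji] : (i < j)%N || (j < i)%N by rewrite -neq_ltn.
    exact: IH eq_f neq_ij lt_ij.
  by apply: IH (esym eq_f) _ lt_ji; rewrite eq_sym.
exists (j - i)%N; first by rewrite subn_gt0.
have : f j (g ^+ j)%g by rewrite /f /lcoset /= mulVg.
by rewrite -eq_f /f /lcoset /= -{1}(subnKC (ltnW lt_ij)) expgnDr mulgA mulVg mul1g.
Qed.

(** * The group ring as an algebra *)

Section GroupRingTheory.
Variables (R : comNzRingType) (G : groupType).
Local Notation RG := (group_ring R G).
Local Notation U := (gring_of R).
Implicit Types (x y z : RG) (g h : G) (c : R).

Lemma gring_ofM g h : U (g * h)%g = U g * U h.
Proof. by rewrite [RHS]gring_mulUU mulr1. Qed.

Lemma gring_of1 : U (1%g : G) = 1.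
Proof. by []. Qed.

Lemma gring_ind (P : RG -> Prop) :
  P 0 -> (forall x y, P x -> P y -> P (x + y)) ->
  (forall c g, P (c *: U g)) -> forall x, P x.
Proof.
move=> P0 PD PU x; rewrite [x]monalgE; apply: (big_ind P) => // g _.
suff -> : << x@_g *g g >> = x@_g *: U g by [].
by apply/malgP => h; rewrite mcoeffZ !mcoeffU mulr_natr.
Qed.

(** Both factors reduce to multiples of group elements, where commutativity of [R] lets [c] pass the
    left coefficient. *)
Lemma gring_scaleAr c x y : c *: (x * y) = x * (c *: y).
Proof.
elim/gring_ind: x => [|x x' IH IH'|d g]; first by rewrite !mul0r scaler0.
  by rewrite !mulrDl scalerDr IH IH'.
elim/gring_ind: y => [|y y' IH IH'|e h]; first by rewrite scaler0 mulr0 scaler0.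
  by rewrite !(mulrDr, scalerDr) IH IH'.
have E a b : (a *: U g) * (b *: U h) = (a * b) *: U (g * h)%g.
  have aE k (r : R) : r *: U k = << r *g k >> :> RG.
    by apply/malgP => l; rewrite mcoeffZ !mcoeffU mulr_natr.
  by rewrite !aE [LHS]gring_mulUU.
by rewrite scalerA !E !scalerA mulrCA.
Qed.

HB.instance Definition _ :=
  GRing.Lalgebra_isAlgebra.Build R RG gring_scaleAr.

(** * The augmentation and its kernel *)

Lemma augmentationE (d : {fset G}) x :
  msupp x `<=` d -> augmentation x = \sum_(g <- d) x@_g.
Proof. by move=> xd; apply: big_fset_incl => // g _ /mcoeff_outdom. Qed.

Lemma augmentationD x y : augmentation (x + y) = augmentation x + augmentation y.
Proof.
rewrite (augmentationE (msuppD_le x y)) (augmentationE (fsubsetUl _ (msupp y))).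
rewrite (augmentationE (fsubsetUr (msupp x) _)) -big_split /=.
by apply: eq_bigr => g _; rewrite mcoeffD.
Qed.

Lemma augmentation0 : augmentation (0 : RG) = 0.
Proof. by rewrite /augmentation msupp0 big_seq_fset0. Qed.

Lemma augmentationZ c x : augmentation (c *: x) = c * augmentation x.
Proof.
rewrite (augmentationE (msuppZ_le c x)) /augmentation mulr_sumr.
by apply: eq_bigr => g _; rewrite mcoeffZ.
Qed.

Lemma augmentationU g : augmentation (U g) = 1.
Proof. by rewrite (augmentationE msuppU_le) big_seq_fset1 mcoeffUU. Qed.

Lemma augmentationM x y : augmentation (x * y) = augmentation x * augmentation y.
Proof.
elim/gring_ind: x => [|x x' IH IH'|c g]; first by rewrite !mul0r !augmentation0 mul0r.
  by rewrite mulrDl !augmentationD IH IH' mulrDl.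
elim/gring_ind: y => [|y y' IH IH'|d h]; first by rewrite !mulr0 !augmentation0 mulr0.
  by rewrite mulrDr !augmentationD IH IH' mulrDr.
rewrite -scalerAl -scalerAr -gring_ofM !augmentationZ !augmentationU.
by rewrite !mulr1.
Qed.

Local Notation I := (augmentation_ideal R G).

Lemma augideal0 : 0 \in I.
Proof. by rewrite inE augmentation0. Qed.

Lemma augidealD x y : x \in I -> y \in I -> x + y \in I.
Proof. by rewrite !inE augmentationD => /eqP-> /eqP->; rewrite addr0. Qed.

Lemma augidealZ c x : x \in I -> c *: x \in I.
Proof. by rewrite !inE augmentationZ => /eqP->; rewrite mulr0. Qed.

Lemma augidealMl x y : y \in I -> x * y \in I.
Proof. by rewrite !inE augmentationM => /eqP->; rewrite mulr0. Qed.

Lemma augidealMr x y : x \in I -> x * y \in I.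
Proof. by rewrite !inE augmentationM => /eqP->; rewrite mul0r. Qed.

Lemma augidealB1 g : U g - 1 \in I.
Proof.
by rewrite inE -scaleN1r augmentationD augmentationZ !augmentationU mulr1 subrr.
Qed.

Lemma augidealU1 g : 1 - U g \in I.
Proof. by rewrite -opprB -scaleN1r; apply/augidealZ/augidealB1. Qed.

(** Subtracting [augmentation x *: 1], which vanishes on the ideal, turns [x] into the combination
    of the [U g - 1] with the coefficients of [x]. *)
Lemma augideal_ind (P : RG -> Prop) :
  P 0 -> (forall x y, P x -> P y -> P (x + y)) ->
  (forall c g, P (c *: (U g - 1))) -> forall x, x \in I -> P x.
Proof.
move=> P0 PD PU x Ix.
have -> : x = x - augmentation x *: 1 by rewrite (eqP Ix) scale0r subr0.
elim/gring_ind: x {Ix} => [|x y Px Py|c g].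
- by rewrite augmentation0 scale0r subr0.
- by rewrite augmentationD scalerDl opprD addrACA; apply: PD.
- by rewrite augmentationZ augmentationU mulr1 -scalerBr.
Qed.

(** * The involution, and one-sided generation of the augmentation ideal *)

Lemma gring_starD x y : gring_star (x + y) = gring_star x + gring_star y.
Proof. by apply/malgP => g; rewrite mcoeffD !gring_starE mcoeffD. Qed.

Lemma gring_starZ c x : gring_star (c *: x) = c *: gring_star x.
Proof. by apply/malgP => g; rewrite mcoeffZ !gring_starE mcoeffZ. Qed.

Lemma gring_star0 : gring_star (0 : RG) = 0.
Proof. by apply/malgP => g; rewrite gring_starE !mcoeff0. Qed.

Lemma gring_starK x : gring_star (gring_star x) = x.
Proof. by apply/malgP => g; rewrite !gring_starE invgK. Qed.

Lemma gring_starU g : gring_star (U g) = U g^-1%g.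
Proof.
by apply/malgP => h; rewrite gring_starE !mcoeffU (can2_eq invgK invgK).
Qed.

Lemma gring_star1 : gring_star (1 : RG) = 1.
Proof. by rewrite gring_starU invg1. Qed.

Lemma gring_starM x y : gring_star (x * y) = gring_star y * gring_star x.
Proof.
elim/gring_ind: x => [|x x' IH IH'|c g].
- by rewrite mul0r gring_star0 mulr0.
- by rewrite mulrDl !gring_starD IH IH' mulrDr.
elim/gring_ind: y => [|y y' IH IH'|d h].
- by rewrite mulr0 gring_star0 mul0r.
- by rewrite mulrDr !gring_starD IH IH' mulrDl.
rewrite -scalerAl -scalerAr -gring_ofM !gring_starZ !gring_starU invgM gring_ofM.
by rewrite -scalerAl -scalerAr !scalerA mulrC.
Qed.

Lemma augmentation_star x : augmentation (gring_star x) = augmentation x.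
Proof.
elim/gring_ind: x => [|x y IH IH'|c g]; first by rewrite gring_star0.
  by rewrite gring_starD !augmentationD IH IH'.
by rewrite gring_starZ gring_starU !augmentationZ !augmentationU.
Qed.

(** The identities [gh - 1 = g(h - 1) + (g - 1)] and [g^-1 - 1 = - g^-1 (g - 1)] reduce every
    [g - 1] to the generators. *)
Lemma augideal_left_gen (S : {fset G}) (P : RG -> Prop) : generates S ->
  P 0 -> (forall x y, P x -> P y -> P (x + y)) ->
  (forall x (s : S), P (x * (1 - U (val s)))) -> forall x, x \in I -> P x.
Proof.
move=> genS P0 PD PS; apply: augideal_ind => // c g.
(* The left factor stays arbitrary because the product and inverse cases change it. *)
suff PU : forall x, P (x * (U g - 1)) by rewrite -[_ - 1]mul1r scalerAl.
have : generated [set` S] g by rewrite genS.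
elim/generated_ind: g / => [|g h IHg IHh|g IH|s Ss] x.
- by rewrite subrr mulr0.
- have -> : x * (U (g * h)%g - 1) = x * U g * (U h - 1) + x * (U g - 1).
    by rewrite gring_ofM !mulrBr !mulr1 mulrA addrA subrK.
  exact: PD.
- have -> : x * (U g^-1%g - 1) = - (x * U g^-1%g) * (U g - 1).
    by rewrite mulNr -mulrN opprB -mulrA [U _ * _]mulrBr mulr1 -gring_ofM mulVg.
  exact: IH.
- have -> : x * (U s - 1) = - x * (1 - U (val [` Ss]%fset)) by rewrite mulNr -mulrN opprB.
  exact: PS.
Qed.

(** The left version transported by the involution, which preserves the ideal. *)
Lemma augideal_right_gen (S : {fset G}) (P : RG -> Prop) : generates S ->
  P 0 -> (forall x y, P x -> P y -> P (x + y)) ->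
  (forall x (s : S), P (gring_star (1 - U (val s)) * x)) ->
  forall x, x \in I -> P x.
Proof.
move=> genS P0 PD PS x Ix; rewrite -[x]gring_starK.
have : gring_star x \in I by rewrite inE augmentation_star.
move: {x Ix}(gring_star x); apply: (augideal_left_gen genS).
- by rewrite gring_star0.
- by move=> x y; rewrite gring_starD; apply: PD.
- by move=> x s; rewrite gring_starM; apply: PS.
Qed.

End GroupRingTheory.

(** * Idempotence of the augmentation ideal *)

Section FiniteAbelianization.
Variables (R : numFieldType) (G : groupType).
Hypothesis finG : finite_set (abelianization G).
Local Notation RG := (group_ring R G).
Local Notation U := (gring_of R).
Local Notation I := (augmentation_ideal R G).

(* I = I^2: modulo I^2 the map [g |-> g - 1] is a homomorphism to a real vector
   space, so it kills commutators and elements of finite order modulo them. *)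
Lemma augideal_mul_ind (P : RG -> Prop) :
  P 0 -> (forall x y, P x -> P y -> P (x + y)) ->
  (forall x y, x \in I -> y \in I -> P (x * y)) -> forall x, x \in I -> P x.
Proof.
(* [J] is membership in I^2, encoded by its additive induction principle. It is closed under
   scalars, while [P] is only assumed additive. *)
pose J z := forall Q : RG -> Prop, Q 0 ->
  (forall x y, Q x -> Q y -> Q (x + y)) ->
  (forall x y, x \in I -> y \in I -> Q (x * y)) -> Q z.
move=> P0 PD PM x Ix; suff : J x by apply.
have J0 : J 0 by move=> Q.
have JD y z : J y -> J z -> J (y + z).
  by move=> Jy Jz Q Q0 QD QM; exact: QD (Jy Q Q0 QD QM) (Jz Q Q0 QD QM).
have JM y z : y \in I -> z \in I -> J (y * z).
  by move=> Iy Iz Q Q0 QD QM; apply: QM.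
have JZ c y : J y -> J (c *: y).
  move=> Jy Q Q0 QD QM; apply: (Jy (fun z => Q (c *: z))).
  - by rewrite scaler0.
  - by move=> z z'; rewrite scalerDr; apply: QD.
  - by move=> z z' Iz Iz'; rewrite scalerAl; apply: QM => //; apply: augidealZ.
have JN y : J y -> J (- y) by rewrite -scaleN1r; apply: JZ.
(* Modulo I^2, [g - 1] is additive in [g]: the error is a product of two elements of I. *)
have UM (g h : G) : U (g * h)%g - 1 = (U g - 1) * (U h - 1) + ((U g - 1) + (U h - 1)).
  rewrite gring_ofM -{1}[U g](subrK 1) -{1}[U h](subrK 1).
  by rewrite mulrDl mulrDr !mulr1 mul1r !addrA addrK.
have JUM g h : J (U g - 1) -> J (U h - 1) -> J (U (g * h)%g - 1).
  move=> Jg Jh; rewrite UM; apply: (JD); last exact: (JD).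
  by apply: JM; apply: augidealB1.
have JUV g : J (U g - 1) -> J (U g^-1%g - 1).
  move=> Jg; have /esym/eqP := UM g g^-1%g.
  rewrite mulgV gring_of1 subrr addrA addr_eq0 -eqr_oppLR => /eqP <-.
  by apply: JN; apply: (JD) => //; apply: JM; apply: augidealB1.
have J1 : J (U (1%g : G) - 1) by rewrite gring_of1 subrr.
have JK g : commutator_subgroup G g -> J (U g - 1).
  elim/generated_ind: g / => // z [g [h ->]].
  have := UM (h * g)%g [~ g, h]%g.
  (* Since [gh = hg [g, h]], the element [[g, h] - 1] is congruent modulo I^2 to the difference of
     [gh - 1] and [hg - 1], hence to 0. *)
  have -> : ((h * g) * [~ g, h] = g * h)%g by rewrite -commgC.
  move=> eU.
  have -> : U [~ g, h]%g - 1 =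
     (U (g * h)%g - 1) - (U (h * g)%g - 1) - (U (h * g)%g - 1) * (U [~ g, h]%g - 1).
    rewrite eU; set b := U _ - 1; set a := U _ - 1.
    by rewrite addrAC [a * b + _]addrC addrK [a + b]addrC addrK.
  apply: (JD); last by apply: JN; apply: JM; apply: augidealB1.
  rewrite !UM [U h - 1 + _]addrC opprD addrACA subrr addr0.
  by apply: (JD); [|apply: JN]; apply: JM; apply: augidealB1.
have JX g N : J (U (g ^+ N)%g - 1 - N%:R *: (U g - 1)).
  elim: N => [|N IH]; first by rewrite scale0r subr0.
  rewrite expgS UM -[N.+1]addn1 natrD scalerDl scale1r.
  have -> (a b c d : RG) : a + (b + c) - (d + b) = a + (c - d).
    by rewrite -addrA [d + b]addrC opprD addrACA subrr add0r.
  by apply: (JD) => //; apply: JM; apply: augidealB1.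
move: x Ix; apply: augideal_ind => // c g; apply: (JZ).
have [N N_gt0 KgN] := expg_commutator_subgroup finG g.
(* Both [g ^+ N - 1] and its difference with [N (g - 1)] lie in I^2, so [N (g - 1)] does too, and
   [N] is invertible in [R]. *)
have := JN _ (JX g N); rewrite opprB => /JD/(_ (JK _ KgN)); rewrite subrK.
move=> /(JZ N%:R^-1); rewrite scalerA mulVf ?scale1r //.
by rewrite pnatr_eq0 -lt0n.
Qed.

(** * Words in the elements [1 - s] *)

Variable S : {fset G}.
Hypothesis genS : generates S.

Definition word_prod n (w : {ffun 'I_n -> S}) : RG :=
  \prod_(i < n) (1 - U (val (w i))).

Definition word_rcons n (w : {ffun 'I_n -> S}) (s : S) : {ffun 'I_n.+1 -> S} :=
  [ffun i => oapp w s (unlift ord_max i)].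

Lemma word_prod_rcons n (w : {ffun 'I_n -> S}) s :
  word_prod (word_rcons w s) = word_prod w * (1 - U (val s)).
Proof.
rewrite /word_prod big_ord_recr /= ffunE unlift_none; congr (_ * _).
apply: eq_bigr => i _; rewrite ffunE.
have -> : widen_ord (leqnSn n) i = lift ord_max i by apply: val_inj; rewrite [RHS]lift_max.
by rewrite liftK.
Qed.

(** Elements of I are sums of triple products from I. The first factor is expanded by right
    generation and the last by left generation; the untouched middle factor keeps the inner element
    in I, so the expansion can be iterated. *)
Lemma augideal_sandwich_ind (P : RG -> Prop) :
  P 0 -> (forall x y, P x -> P y -> P (x + y)) ->
  (forall (s t : S) x, x \in I ->
     P (gring_star (1 - U (val s)) * x * (1 - U (val t)))) ->
  forall x, x \in I -> P x.
Proof.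
move=> P0 PD PS; apply: augideal_mul_ind => // x y + Iy; move: x.
apply: (augideal_mul_ind (P := fun x => P (x * y))).
- by rewrite mul0r.
- by move=> x x'; rewrite mulrDl; apply: PD.
move=> x x' Ix Ix'; move: y Iy.
apply: (augideal_left_gen genS (P := fun y => P (x * x' * y))).
- by rewrite mulr0.
- by move=> y y'; rewrite mulrDr; apply: PD.
move=> y t; move: x Ix.
apply: (augideal_right_gen genS (P := fun x => P (x * x' * (y * _)))).
- by rewrite !mul0r.
- by move=> x z; rewrite !mulrDl; apply: PD.
move=> x s; rewrite mulrA -[_ * x * x']mulrA -[_ * _ * y]mulrA.
by apply: PS; apply/augidealMr/augidealMl.
Qed.

(** Induction on [n]: the induction hypothesis applies to the inner element of a sandwich, and the
    outer letters [s] and [t] become the last letters of the two words. *)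
Lemma augideal_word_ind n (P : RG -> Prop) :
  P 0 -> (forall x y, P x -> P y -> P (x + y)) ->
  (forall (w w' : {ffun 'I_n -> S}) c g,
     P (gring_star (word_prod w) * (c *: U g) * word_prod w')) ->
  forall x, x \in I -> P x.
Proof.
elim: n P => [|n IH] P P0 PD PW.
  move=> x _; elim/gring_ind: x => // c g.
  have w0 : {ffun 'I_0 -> S} by apply: finfun => -[].
  by have := PW w0 w0 c g; rewrite /word_prod big_ord0 gring_star1 mul1r mulr1.
apply: augideal_sandwich_ind => // s t; apply: IH.
- by rewrite mulr0 mul0r.
- by move=> x y; rewrite [_ * (x + y)]mulrDr mulrDl; apply: PD.
move=> w w' c g; have := PW (word_rcons w s) (word_rcons w' t) c g.
by rewrite !word_prod_rcons gring_starM !mulrA.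
Qed.

Lemma star_word_prod n (w : {ffun 'I_n -> S}) :
  gring_star (word_prod w) =
  \prod_(i < n) gring_star (1 - U (val (w (rev_ord i)))).
Proof.
rewrite /word_prod; elim: n w => [|n IH] w; first by rewrite !big_ord0 gring_star1.
rewrite big_ord_recr big_ord_recl gring_starM /=; congr (_ * _).
  by congr (gring_star (1 - U (val (w _)))); apply: val_inj; rewrite /= subn1.
pose w' : {ffun 'I_n -> S} := [ffun i => w (widen_ord (leqnSn n) i)].
rewrite (eq_bigr (fun i => 1 - U (val (w' i)))) => [|i _]; last by rewrite ffunE.
rewrite IH; apply: eq_bigr => i _; rewrite ffunE.
by congr (gring_star (1 - U (val (w _)))); apply: val_inj.
Qed.

Lemma squareE n :
  square R S n =
  \sum_(w : {ffun 'I_n -> S}) gring_star (word_prod w) * word_prod w.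
Proof. by apply: eq_bigr => w _; rewrite star_word_prod. Qed.

(** For positive [n] each word has a last factor [1 - s], which lies in the ideal; [square] at 0 is
    1. *)
Lemma square_augideal n : (0 < n)%N -> square R S n \in I.
Proof.
case: n => // n _; rewrite squareE; apply: (big_rec (fun x => x \in I)) => [|w x _ Ix].
  exact: augideal0.
apply/augidealD => //; apply: augidealMl; rewrite /word_prod big_ord_recr.
by apply: augidealMl; apply: augidealU1.
Qed.

End FiniteAbelianization.

(** * Sums of hermitian squares of matrices over an algebra with involution *)

Section HermitianMatrices.
Variables (R : realFieldType) (A : algType R) (star : A -> A).
Hypothesis starD : forall x y, star (x + y) = star x + star y.
Hypothesis starM : forall x y, star (x * y) = star y * star x.
Hypothesis starZ : forall (c : R) x, star (c *: x) = c *: star x.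
Hypothesis starK : involutive star.
Variable k : nat.
Implicit Types (X Y : 'M[A]_k) (x y : A) (i j : 'I_k).
Local Notation mstar := (@mx_star A star k).
Local Notation mscale := (@mx_scale R A k).
Local Notation sos := (@sum_of_hermitian_squares 'M[A]_k mstar).

Definition entry_mx i j x : 'M[A]_k := x *: delta_mx i j.

Lemma entry_mxE i j x a b :
  entry_mx i j x a b = if (a == i) && (b == j) then x else 0.
Proof. by rewrite !mxE; case: ifP; rewrite ?mulr1 ?mulr0. Qed.

Lemma entry_mxM i j l x y : entry_mx i j x * entry_mx j l y = entry_mx i l (x * y).
Proof.
apply/matrixP => a b; rewrite mxE entry_mxE (bigD1 j) //= !entry_mxE !eqxx andbT.
rewrite big1 ?addr0 => [|c /negPf jc]; last by rewrite entry_mxE jc andbF mul0r.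
by case: (a == i); case: (b == l); rewrite /= ?mul0r ?mulr0.
Qed.

Lemma entry_mxD i j x y : entry_mx i j (x + y) = entry_mx i j x + entry_mx i j y.
Proof. exact: scalerDl. Qed.

Lemma star0 : star 0 = 0.
Proof. by rewrite -(scale0r 0) starZ !scale0r. Qed.

Lemma mx_star_entry i j x : mstar (entry_mx i j x) = entry_mx j i (star x).
Proof.
apply/matrixP => a b; rewrite 2!mxE !entry_mxE andbC.
by case: ifP => // _; rewrite star0.
Qed.

Lemma mx_starD X Y : mstar (X + Y) = mstar X + mstar Y.
Proof. by apply/matrixP => a b; rewrite !mxE starD. Qed.

Lemma mx_scaleDl c d X : mscale (c + d) X = mscale c X + mscale d X.
Proof. by apply/matrixP => a b; rewrite !mxE scalerDl. Qed.

Lemma mx_entry_sum X : X = \sum_i \sum_j entry_mx i j (X i j).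
Proof.
apply/matrixP => a b; rewrite summxE (bigD1 a) //= summxE (bigD1 b) //=.
rewrite entry_mxE !eqxx /= !big1 ?addr0 // => [i /negPf ia|j /negPf jb].
  by rewrite summxE big1 // => j _; rewrite entry_mxE eq_sym ia.
by rewrite entry_mxE eqxx eq_sym jb.
Qed.

Lemma sos_hermitian_square X : sos (mstar X * X).
Proof. by exists [:: X]; rewrite big_seq1. Qed.

Lemma sos0 : sos 0.
Proof. by exists [::]; rewrite big_nil. Qed.

Lemma sosD X Y : sos X -> sos Y -> sos (X + Y).
Proof. by move=> [s ->] [t ->]; exists (s ++ t); rewrite big_cat. Qed.

Lemma sos_sum (J : Type) (r : seq J) (P : pred J) (F : J -> 'M[A]_k) :
  (forall a, P a -> sos (F a)) -> sos (\sum_(a <- r | P a) F a).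
Proof. by move=> sosF; apply: big_ind => //; [apply: sos0 | apply: sosD]. Qed.

(** The order unit condition stripped of membership in the subspace, so that it can be proved term
    by term. *)
Definition dominated (u X : 'M[A]_k) :=
  exists2 r : R, 0 <= r & sos (X + mscale r u).

Lemma dominated0 u : dominated u 0.
Proof.
exists 0 => //; rewrite add0r [mscale _ _](_ : _ = 0); first exact: sos0.
by apply/matrixP => a b; rewrite !mxE scale0r.
Qed.

Lemma dominatedD u X Y : dominated u X -> dominated u Y -> dominated u (X + Y).
Proof.
move=> [r r0 sX] [t t0 sY]; exists (r + t); first exact: addr_ge0.
by rewrite mx_scaleDl addrACA; apply: sosD.
Qed.

Lemma dominated_cross0 u i j :
  dominated u (entry_mx i j 0 + entry_mx j i (star 0)).
Proof. by rewrite star0 /entry_mx !scale0r addr0; apply: dominated0. Qed.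

Lemma dominated_crossD u i j x y :
  dominated u (entry_mx i j x + entry_mx j i (star x)) ->
  dominated u (entry_mx i j y + entry_mx j i (star y)) ->
  dominated u (entry_mx i j (x + y) + entry_mx j i (star (x + y))).
Proof. by rewrite starD !entry_mxD addrACA; apply: dominatedD. Qed.

(** A hermitian [X] is half of [X] plus its star, so half of each entry is paired with its star at
    the transposed position; domination is additive. *)
Lemma dominated_hermitian u X : mstar X = X ->
  (forall i j, dominated u (entry_mx i j (2^-1 *: X i j) +
                            entry_mx j i (star (2^-1 *: X i j)))) ->
  dominated u X.
Proof.
move=> hX domX.
have -> : X = \sum_i \sum_j (entry_mx i j (2^-1 *: X i j) +
                             entry_mx j i (star (2^-1 *: X i j))).
  under eq_bigr do rewrite big_split; rewrite big_split /=.
  (* After the exchange both halves sit at [(i, j)]: the second is the star of half of [X j i], that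
     is half of [X i j]. *)
  rewrite [X in _ = _ + X]exchange_big -big_split {1}[X]mx_entry_sum /=.
  apply: eq_bigr => i _; rewrite -big_split; apply: eq_bigr => j _ /=.
  have -> : X j i = star (X i j) by rewrite -{1}hX !mxE.
  by rewrite starZ starK -entry_mxD -scalerDl -[2^-1]mulr1 -mulrDr mulVf ?scale1r ?pnatr_eq0.
apply: (big_ind (dominated u)) => [|Y Z|i _]; first exact: dominated0.
  exact: dominatedD.
apply: (big_ind (dominated u)) => [|Y Z|j _]; first exact: dominated0.
  exact: dominatedD.
exact: domX.
Qed.

(** * Domination by a diagonal sum of squares *)

Variables (T : finType) (p : T -> A).
Local Notation u := ((\sum_t star (p t) * p t)%:M : 'M[A]_k).

Lemma mx_scale_diag_sum c :
  mscale c u = \sum_i \sum_t entry_mx i i (c *: (star (p t) * p t)).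
Proof.
apply/matrixP => a b; rewrite !mxE summxE (bigD1 a) //= summxE.
rewrite [X in _ + X]big1 => [|i /negPf ia]; last first.
  by rewrite summxE big1 // => w _; rewrite entry_mxE eq_sym ia.
rewrite addr0; case: (eqVneq a b) => [<-|/negPf ab].
  by rewrite scaler_sumr; apply: eq_bigr => w _; rewrite entry_mxE eqxx.
by rewrite scaler0 big1 // => w _; rewrite entry_mxE eqxx eq_sym ab.
Qed.

(** The diagonal sum consists of the squares of the [entry_mx j j (c *: p v)], so deleting one term
    leaves a sum of squares. The coefficient is [c ^+ 2] because [R] need not contain square
    roots. *)
Lemma sos_diag_sub_entry c i t :
  sos (mscale (c ^+ 2) u - entry_mx i i (c ^+ 2 *: (star (p t) * p t))).
Proof.
have sosE j v : sos (entry_mx j j (c ^+ 2 *: (star (p v) * p v))).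
  pose X := entry_mx j j (c *: p v).
  suff -> : entry_mx j j (c ^+ 2 *: (star (p v) * p v)) = mstar X * X.
    exact: sos_hermitian_square.
  by rewrite mx_star_entry entry_mxM starZ -scalerAl -scalerAr scalerA.
rewrite mx_scale_diag_sum (bigD1 i) //= (bigD1 t) //=.
have E (a b d : 'M[A]_k) : a + b + d - a = b + d.
  by rewrite addrAC [a + b]addrC addrK.
rewrite E; apply: sosD; first by apply: sos_sum.
by apply: sos_sum => j _; apply: sos_sum.
Qed.

(* With Z = E_ii p_s + E_ij y, the cross terms of Z^* Z are the given matrix,
   and its diagonal terms are bounded by multiples of u. *)
Lemma dominated_cross_terms i j s t c y :
  star y * y = c ^+ 2 *: (star (p t) * p t) ->
  dominated u (entry_mx i j (star (p s) * y) +
               entry_mx j i (star (star (p s) * y))).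
Proof.
(* [1 ^+ 2] pays for the diagonal term of [p s] and [c ^+ 2] for that of [y]; the first is written
   as a square to fit [sos_diag_sub_entry]. *)
move=> yy; exists (1 ^+ 2 + c ^+ 2); first by rewrite addr_ge0 ?sqr_ge0.
pose Z := entry_mx i i (p s) + entry_mx i j y.
have -> : entry_mx i j (star (p s) * y) + entry_mx j i (star (star (p s) * y)) =
    mstar Z * Z - entry_mx i i (1 ^+ 2 *: (star (p s) * p s))
      - entry_mx j j (c ^+ 2 *: (star (p t) * p t)).
  rewrite /Z mx_starD !mx_star_entry mulrDr !mulrDl !entry_mxM yy expr1n scale1r.
  rewrite starM starK.
  move: (entry_mx i i _) (entry_mx j j _) (entry_mx i j _) (entry_mx j i _).
  move=> a b d e; rewrite -addrA -opprD [d + b]addrC addrACA.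
  by rewrite [X in X - _]addrC addrK addrC.
have E (z a b m m' : 'M[A]_k) : z - a - b + (m + m') = z + (m - a) + (m' - b).
  by rewrite addrACA -[z - a + m]addrA [- a + m]addrC [- b + m']addrC.
rewrite mx_scaleDl E; apply: sosD; last exact: sos_diag_sub_entry.
by apply: sosD; [apply: sos_hermitian_square | apply: sos_diag_sub_entry].
Qed.
End HermitianMatrices.

(** * From matrices to the order unit statements *)

Lemma sum_of_hermitian_squares_mx11 (A : nzRingType) (star : A -> A) (X : 'M[A]_1) :
  sum_of_hermitian_squares (@mx_star A star 1) X ->
  sum_of_hermitian_squares star (X ord0 ord0).
Proof.
move=> [s ->]; exists [seq Y ord0 ord0 | Y : 'M_1 <- s].
rewrite big_map summxE; apply: eq_bigr => Y _.
by rewrite mxE big_ord1 !mxE.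
Qed.

(** The size [k] is kept free: it becomes the number of generators for the matrix statement and 1
    for the scalar one. *)
Lemma mx_square_order_unit (R : realFieldType) (G : groupType) (S : {fset G})
    (n k : nat) :
  generates S -> finite_set (abelianization G) -> (0 < n)%N ->
  order_unit (R := R) (A := 'M[group_ring R G]_k)
    (@mx_scale R (group_ring R G) k)
    (@mx_star (group_ring R G) (@gring_star R G) k)
    [pred M | M \is a mxOver (augmentation_ideal R G)] (square R S n)%:M.
Proof.
move=> genS finG n_gt0; have Iu := square_augideal R S n_gt0.
split=> [|X IX hX].
  apply/mxOverP => i j; rewrite mxE; case: (i == j); first exact: Iu.
  exact: augideal0.
have [r r_ge0 sX] : dominated (@gring_star R G) (square R S n)%:M X.
  apply: dominated_hermitian hX _.
  - exact: gring_starZ.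
  - exact: gring_starK.
  move=> i j; have : 2^-1 *: X i j \in augmentation_ideal R G.
    by apply: augidealZ; move/mxOverP: IX; apply.
  move: (_ *: _); apply: (augideal_word_ind finG genS (n := n)).
  - by apply: dominated_cross0; apply: gring_starZ.
  - by move=> x y; apply: dominated_crossD; apply: gring_starD.
  move=> w w' c g; rewrite -[gring_star _ * _ * _]mulrA squareE.
  (* The group element cancels, as [g^-1 g = 1]; this is the condition on [y] in
     [dominated_cross_terms]. *)
  have yy : gring_star (c *: gring_of R g * word_prod R w') *
      (c *: gring_of R g * word_prod R w') =
      c ^+ 2 *: (gring_star (word_prod R w') * word_prod R w').
    rewrite gring_starM gring_starZ gring_starU -mulrA -!scalerAl -!scalerAr scalerA.
    by rewrite [gring_of R _ * _]mulrA -gring_ofM mulVg gring_of1 mul1r.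
  apply: dominated_cross_terms yy.
  - exact: gring_starD.
  - exact: gring_starM.
  - exact: gring_starZ.
  - exact: gring_starK.
exists r => //; split=> //.
apply/mxOverP => i j; rewrite !mxE; apply: augidealD.
  by move/mxOverP: IX; apply.
apply: augidealZ; case: (i == j); first exact: Iu.
exact: augideal0.
Qed.

Theorem theorem1 (R : realType) (G : groupType) (S : {fset G})
    (hS : generates S) (hG : finite_set (abelianization G))
    (n : nat) (hn : (1 <= n)%N) :
  order_unit (R := R) (A := group_ring R G) *:%R (@gring_star R G)
    (augmentation_ideal R G) (square R S n)
  /\
  order_unit (R := R) (A := 'M[group_ring R G]_(#|` S|))
    (@mx_scale R (group_ring R G) _) (@mx_star (group_ring R G) (@gring_star R G) _)
    [pred M | M \is a mxOver (augmentation_ideal R G)] (square R S n)%:M.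
Proof.
split; last exact: mx_square_order_unit.
have Iu := square_augideal R S hn; split=> // v Iv hv.
have [_ ordU] := mx_square_order_unit R 1 hS hG hn.
(* The scalar [v] is read as a hermitian 1 x 1 matrix; the sole entry of the resulting sum of
   squares gives the scalar one. *)
have [||r r_ge0 [_ sos_v]] := ordU v%:M.
- by apply/mxOverP => i j; rewrite mxE !ord1.
- by apply/matrixP => i j; rewrite !mxE !ord1 eqxx.
exists r => //; split; first by apply: augidealD => //; apply: augidealZ.
by have := sum_of_hermitian_squares_mx11 sos_v; rewrite !mxE eqxx.
Qed.
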